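(* Consider the contextual two-sided market with $n$ sellers and $n$ buyers: seller $i$ has unknown $\theta^s_i\in\mathbb B_d$, buyer $j$ unknown $\theta^b_j\in\mathbb B_d$, and in round $t$ an adversarial context $x_t\in\mathbb B_d$ is revealed, giving costs $c_{i,t}=\langle\theta^s_i,x_t\rangle$ and values $v_{j,t}=\langle\theta^b_j,x_t\rangle$ in $[0,1]$. Run the following algorithm (Ellipsoid Search in Two-Sided Markets) with $\delta=1/T$. Each trader has an ellipsoid, initially $\mathbb B_d$. In round $t$, for each seller let $\bar c_{i,t},\underline c_{i,t}$ be the max and min of $\langle\theta,x_t\rangle$ over the seller's ellipsoid, and similarly $\bar v_{j,t},\underline v_{j,t}$ for buyers. If some seller has $\bar c_{i,t}-\underline c_{i,t}>\delta$, pick one, post the single price $(\bar c_{i,t}+\underline c_{i,t})/2$ to all traders, and replace that seller's ellipsoid by the minimum-volume ellipsoid containing its intersection with the half-space consistent with that seller's feedback ($\{\theta:\langle\theta,x_t\rangle\le p\}$ if it accepted price $p$, $\{\theta:\langle\theta,x_t\rangle\ge p\}$ otherwise); else if some buyer has $\bar v_{j,t}-\underline v_{j,t}>\delta$, do the symmetric step for that buyer; otherwise keep all ellipsoids and post the segmented-price mechanism: compute a GFT-maximizing matching $M$ for costs $\bar c_{i,t}$ and values $\underline v_{j,t}$, with matched sets $S_1,B_1$; post $\max_{i\in S_1}\bar c_{i,t}$ to $S_1$, $0$ to other sellers, $\min_{j\in B_1}\underline v_{j,t}$ to $B_1$, and $1$ to other buyers. Then the cumulative gains-from-trade regret is $O(n^2d^2\log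 T)$.
   Context: $\mathbb B_d$ is the closed unit ball in $\mathbb R^d$. A seller accepts a price $p$ iff $p\ge$ its current cost; a buyer accepts price $q$ iff $q\le$ its current value (ties in favour of accepting). In each round a maximum-cardinality matching between accepting sellers and buyers is formed, with GFT $\sum_{(i,j)\in M}(v_{j,t}-c_{i,t})$. Round-$t$ benchmark $\mathrm{GFT}^\star_t$ is the maximum GFT over all matchings for the round-$t$ costs and values; round-$t$ regret is $\mathrm{GFT}^\star_t$ minus the minimum GFT over maximum-cardinality matchings of accepting traders; cumulative regret is the sum over $t=1,\dots,T$. *)

(* Defs.v *)
From HB Require Import structures.
From mathcomp Require Import all_boot all_order all_algebra.
From mathcomp Require Import reals exp.
Set Implicit Arguments. Unset Strict Implicit. Unset Printing Implicit Defensive.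
Import Order.TTheory GRing.Theory Num.Theory.
Local Open Scope ring_scope.

Section Market.
Variable R : realType.

Definition inner d (u v : 'cV[R]_d) : R := \sum_(k < d) u k 0 * v k 0.
Definition in_ball d (u : 'cV[R]_d) : Prop := inner u u <= 1.

(* An ellipsoid {th | (th - c)^T A^{-1} (th - c) <= 1}, A positive definite. *)
Record ellipsoid d := Ell { ecenter : 'cV[R]_d; eshape : 'M[R]_d }.

Definition pos_def d (A : 'M[R]_d) : Prop :=
  A^T = A /\ forall z : 'cV[R]_d, z != 0 -> 0 < (z^T *m A *m z) 0 0.

Definition is_ellipsoid d (E : ellipsoid d) : Prop := pos_def (eshape E).

Definition in_ell d (E : ellipsoid d) (th : 'cV[R]_d) : Prop :=
  let w := th - ecenter E in (w^T *m invmx (eshape E) *m w) 0 0 <= 1.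

Definition unit_ell d : ellipsoid d := Ell 0 1%:M.

(* E is a minimum-volume ellipsoid containing K.  The volume of the
   ellipsoid (c, A) is vol(B_d) * sqrt(det A), so minimising the volume is
   minimising det A. *)
Definition is_mvee d (K : 'cV[R]_d -> Prop) (E : ellipsoid d) : Prop :=
  is_ellipsoid E /\ (forall th, K th -> in_ell E th) /\
  forall E', is_ellipsoid E' -> (forall th, K th -> in_ell E' th) ->
    \det (eshape E) <= \det (eshape E').

Definition is_max_lin d (E : ellipsoid d) (x : 'cV[R]_d) (u : R) : Prop :=
  (exists th, in_ell E th /\ inner th x = u) /\
  forall th, in_ell E th -> inner th x <= u.
Definition is_min_lin d (E : ellipsoid d) (x : 'cV[R]_d) (u : R) : Prop :=
  (exists th, in_ell E th /\ inner th x = u) /\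
  forall th, in_ell E th -> u <= inner th x.

Definition matching n (M : {set 'I_n * 'I_n}) : bool :=
  [forall e1 in M, forall e2 in M,
     ((e1.1 == e2.1) || (e1.2 == e2.2)) ==> (e1 == e2)].

Definition gft n (c v : 'I_n -> R) (M : {set 'I_n * 'I_n}) : R :=
  \sum_(e in M) (v e.2 - c e.1).

(* benchmark GFT*: maximum GFT over all matchings (the empty matching,
   with GFT 0, is always a matching, so the initial value 0 is harmless) *)
Definition opt_gft n (c v : 'I_n -> R) : R :=
  \big[Num.max/0]_(M | matching M) gft c v M.

Definition acc_matching n (ps pb c v : 'I_n -> R) (M : {set 'I_n * 'I_n}) : bool :=
  matching M && [forall e in M, (c e.1 <= ps e.1) && (pb e.2 <= v e.2)].

Definition maxcard_acc n (ps pb c v : 'I_n -> R) (M : {set 'I_n * 'I_n}) : bool :=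
  acc_matching ps pb c v M &&
  [forall M' : {set 'I_n * 'I_n}, acc_matching ps pb c v M' ==> (#|M'| <= #|M|)%N].

(* minimum GFT over maximum-cardinality matchings of accepting traders.
   This set is nonempty and every GFT is <= opt_gft, so the initial value
   opt_gft does not affect the minimum. *)
Definition worst_gft n (ps pb c v : 'I_n -> R) : R :=
  \big[Num.min/opt_gft c v]_(M | maxcard_acc ps pb c v M) gft c v M.

Definition round_regret n (ps pb c v : 'I_n -> R) : R :=
  opt_gft c v - worst_gft ps pb c v.

(* One round of "Ellipsoid Search in Two-Sided Markets" with threshold delta:
   from the ellipsoids ES, EB (sellers, buyers) and context xt, the algorithm
   posts prices ps (to sellers), pb (to buyers) and moves to ES', EB'.
   Nondeterministic choices (which trader is picked, which GFT-maximising
   matching is used, which MVEE) are universally covered by the theorem. *)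
Definition alg_round n d (delta : R) (thS thB : 'I_n -> 'cV[R]_d) (xt : 'cV[R]_d)
    (ES EB ES' EB' : 'I_n -> ellipsoid d) (ps pb : 'I_n -> R) : Prop :=
  exists cU cL vU vL : 'I_n -> R,
    (forall i, is_max_lin (ES i) xt (cU i) /\ is_min_lin (ES i) xt (cL i)) /\
    (forall j, is_max_lin (EB j) xt (vU j) /\ is_min_lin (EB j) xt (vL j)) /\
    [\/
        exists i, delta < cU i - cL i /\
          let p := (cU i + cL i) / 2 in
          (forall k, ps k = p) /\ (forall k, pb k = p) /\
          EB' = EB /\ (forall k, k != i -> ES' k = ES k) /\
          is_mvee (fun th => in_ell (ES i) th /\
                     (if inner (thS i) xt <= p then inner th xt <= p
                      else p <= inner th xt)) (ES' i),
        (forall i, cU i - cL i <= delta) /\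
        exists j, delta < vU j - vL j /\
          let p := (vU j + vL j) / 2 in
          (forall k, ps k = p) /\ (forall k, pb k = p) /\
          ES' = ES /\ (forall k, k != j -> EB' k = EB k) /\
          is_mvee (fun th => in_ell (EB j) th /\
                     (if p <= inner (thB j) xt then p <= inner th xt
                      else inner th xt <= p)) (EB' j)
      |
        [/\ forall i, cU i - cL i <= delta,
            forall j, vU j - vL j <= delta,
            ES' = ES, EB' = EB &
            exists M : {set 'I_n * 'I_n},
              [/\ matching M,
                  forall M', matching M' -> gft cU vL M' <= gft cU vL M,
                  forall k, ps k = if k \in [set e.1 | e in M]
                                   then \big[Num.max/cU k]_(i in [set e.1 | e in M]) cU i
                                   else 0 &
                  forall k, pb k = if k \in [set e.2 | e in M]
                                   then \big[Num.min/vL k]_(j in [set e.2 | e in M]) vL j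
                                   else 1]]].

End Market.

(* Main.v *)
(** In a round posting a single price every trade has nonnegative gain, so the
regret is at most [n]; in a round posting segmented prices it is at most
[2 n / T].  It remains to bound the number of ellipsoid updates per trader.

Let [E = (c, A)] be cut through its centre orthogonally to [x], and let
[s^2 = x^T A x], so that [E] has width [2 s] along [x].  The minimum-volume
ellipsoid of the half-ellipsoid is unique, with shape [A'] given by
[A'^-1 = (1 - 1/d^2) A^-1 + 2 (d+1)/d^2 * x x^T / s^2].  Hence [\det A] drops by
a factor [exp (- 1/(d+1))] at least, while [s > delta/2] keeps
[\tr A^-1 <= 8 (d+1) / delta^2] invariant, so [\det A^-1 <= (16 / delta^2)^d] by
AM-GM.  Each trader is therefore updated at most
[d (d+1) ln (16 T^2) = O(d^2 ln T)] times. *)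
Require Import Defs.
From HB Require Import structures.
From mathcomp Require Import all_boot all_order all_algebra.
From mathcomp Require Import reals sequences exp.
From mathcomp Require Import ring lra.
Import Order.TTheory GRing.Theory Num.Theory.
Local Open Scope ring_scope.
Set Implicit Arguments. Unset Strict Implicit. Unset Printing Implicit Defensive.

(** * Bilinear forms and inner products *)

Definition bform {R : realType} {d} (A : 'M[R]_d) (u v : 'cV[R]_d) : R :=
  (u^T *m A *m v) 0 0.

Section BilinearForms.
Context {R : realType} {d : nat}.
Implicit Types (A B P : 'M[R]_d) (u v w : 'cV[R]_d).

Lemma bformDl A u v w : bform A (u + v) w = bform A u w + bform A v w.
Proof. by rewrite /bform linearD /= !mulmxDl mxE. Qed.
Lemma bformDr A u v w : bform A u (v + w) = bform A u v + bform A u w.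
Proof. by rewrite /bform mulmxDr mxE. Qed.
Lemma bformZl A a u w : bform A (a *: u) w = a * bform A u w.
Proof. by rewrite /bform linearZ /= -!scalemxAl mxE. Qed.
Lemma bformZr A a u w : bform A u (a *: w) = a * bform A u w.
Proof. by rewrite /bform -scalemxAr mxE. Qed.
Lemma bformNl A u w : bform A (- u) w = - bform A u w.
Proof. by rewrite -scaleN1r bformZl mulN1r. Qed.
Lemma bformNr A u w : bform A u (- w) = - bform A u w.
Proof. by rewrite -scaleN1r bformZr mulN1r. Qed.
Lemma bformC A u v : A^T = A -> bform A u v = bform A v u.
Proof.
move=> symA; rewrite /bform; transitivity ((u^T *m A *m v)^T 0 0); first by rewrite [RHS]mxE.
by rewrite !trmx_mul trmxK symA mulmxA.
Qed.
Lemma bformMD A B u v : bform (A + B) u v = bform A u v + bform B u v.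
Proof. by rewrite /bform mulmxDr mulmxDl mxE. Qed.
Lemma bformMZ a A u v : bform (a *: A) u v = a * bform A u v.
Proof. by rewrite /bform -scalemxAr -scalemxAl mxE. Qed.
Lemma bform_congr P A u v : bform (P^T *m A *m P) u v = bform A (P *m u) (P *m v).
Proof. by rewrite /bform trmx_mul !mulmxA. Qed.
Lemma bform_delta A i : bform A (delta_mx i 0) (delta_mx i 0) = A i i.
Proof. by rewrite /bform trmx_delta -mulmxA -colE -rowE !mxE. Qed.
Lemma innerE u v : inner u v = bform 1%:M u v.
Proof. by rewrite /bform mulmx1 /inner mxE; apply: eq_bigr => k _; rewrite mxE. Qed.
Lemma innerDl u v w : inner (u + v) w = inner u w + inner v w.
Proof. by rewrite !innerE bformDl. Qed.
Lemma innerDr u v w : inner u (v + w) = inner u v + inner u w.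
Proof. by rewrite !innerE bformDr. Qed.
Lemma innerZl a u w : inner (a *: u) w = a * inner u w.
Proof. by rewrite !innerE bformZl. Qed.
Lemma innerZr a u w : inner u (a *: w) = a * inner u w.
Proof. by rewrite !innerE bformZr. Qed.
Lemma innerNl u w : inner (- u) w = - inner u w.
Proof. by rewrite !innerE bformNl. Qed.
Lemma innerNr u w : inner u (- w) = - inner u w.
Proof. by rewrite !innerE bformNr. Qed.
Lemma bform_outer x u : bform (x *m x^T) u u = inner u x ^+ 2.
Proof.
rewrite /bform innerE /bform mulmx1 mulmxA -mulmxA mxE big_ord1 expr2.
congr (_ * _); transitivity ((x^T *m u)^T 0 0); first by rewrite [RHS]mxE.
by rewrite trmx_mul trmxK.
Qed.
Lemma inner_delta u i : inner u (delta_mx i 0) = u i 0.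
Proof.
rewrite /inner (bigD1 i) //= big1 ?addr0 ?mxE ?eqxx ?mulr1 // => j ji.
by rewrite mxE (negbTE ji) mulr0.
Qed.
Lemma inner_trmx P u v : inner (P *m u) v = inner u (P^T *m v).
Proof. by rewrite !innerE /bform !mulmx1 trmx_mul mulmxA. Qed.
Lemma innerC u v : inner u v = inner v u.
Proof. by rewrite !innerE bformC ?trmx1. Qed.
Lemma inner_ge0 u : 0 <= inner u u.
Proof. by apply: sumr_ge0 => k _; rewrite -expr2 sqr_ge0. Qed.
Lemma inner_eq0 u : (inner u u == 0) = (u == 0).
Proof.
apply/idP/eqP => [|->]; last by rewrite /inner big1 // => k _; rewrite mxE mul0r.
rewrite psumr_eq0 => [/allP z|k _]; last by rewrite -expr2 sqr_ge0.
apply/colP => k; rewrite mxE; apply/eqP.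
by have := z k; rewrite mem_index_enum mulf_eq0 orbb => /(_ isT).
Qed.

Lemma pos_def_ge0 A u : pos_def A -> 0 <= bform A u u.
Proof.
move=> [_ pA]; have [->|u0] := eqVneq u 0; last exact: ltW (pA _ u0).
by rewrite /bform mulmx0 mxE.
Qed.
Lemma pos_def_congr P A : P \in unitmx -> pos_def A -> pos_def (P^T *m A *m P).
Proof.
move=> uP [sA pA]; split; first by rewrite !trmx_mul trmxK sA mulmxA.
move=> z z0; rewrite -[X in _ < X]/(bform _ z z) bform_congr; apply: pA.
by apply: contraNneq z0 => Pz; rewrite -(mulKmx uP z) Pz mulmx0.
Qed.
Lemma pos_def1 : pos_def (1%:M : 'M[R]_d).
Proof.
split; first exact: trmx1.
by move=> z z0; rewrite -[X in _ < X]/(bform _ z z) -innerE lt_def inner_ge0 inner_eq0 z0.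
Qed.
End BilinearForms.

(** * Positive definite matrices: factorisation, determinant against trace, adapted frames *)

Section PositiveDefinite.
Context {R : realType}.

Lemma pos_def_schur n (A : 'M[R]_(1 + n)) : pos_def A ->
  exists (a : R) (b : 'cV[R]_n) (S : 'M[R]_n),
  [/\ 0 < a, pos_def S & A = block_mx a%:M b^T b (S + a^-1 *: (b *m b^T))].
Proof.
move=> [sA pA]; pose a := ulsubmx A 0 0; pose b := dlsubmx A.
have ba : ursubmx A = b^T by rewrite /b trmx_dlsub sA.
have eA : A = block_mx a%:M b^T b (drsubmx A).
  by rewrite -{1}[A]submxK ba [ulsubmx A]mx11_scalar.
have sD : (drsubmx A)^T = drsubmx A by rewrite trmx_drsub sA.
have a_gt0 : 0 < a.
  suff : 0 < bform A (delta_mx (lshift n 0) 0) (delta_mx (lshift n 0) 0).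
    by rewrite bform_delta eA block_mxEul mxE eqxx.
  apply: pA.
  by apply/eqP => /matrixP /(_ (lshift n 0) 0) /eqP; rewrite !mxE !eqxx oner_eq0.
exists a, b, (drsubmx A - a^-1 *: (b *m b^T)); split => //; last by rewrite subrK.
split; first by rewrite linearB /= sD linearZ /= trmx_mul trmxK.
(* The upper entry of [w] minimises the form of [A] over vectors with lower block [z]; the minimum
   is the Schur complement's form at [z]. *)
move=> z z0; pose w : 'cV[R]_(1 + n) := col_mx (- a^-1 *: (b^T *m z)) z.
have w0 : w != 0.
  by apply: contra_neq z0 => w0; rewrite -(col_mxKd (- a^-1 *: (b^T *m z)) z) -/w w0 linear0.
have := pA w w0; congr (_ < _).
rewrite {1}eA /w tr_col_mx mul_row_block mul_row_col !mulmxDl !mulmxBr !mulmxBl.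
rewrite !linearZ /= ?trmx_mul ?trmxK !mul_mx_scalar -!scalemxAl !mulmxA.
move: (z^T *m b *m b^T *m z) (z^T *m _ *m z) => p q; rewrite !mxE.
by field; rewrite gt_eqF.
Qed.

Lemma det_schur n a (b : 'cV[R]_n) (S : 'M[R]_n) : 0 < a ->
  \det (block_mx a%:M b^T b (S + a^-1 *: (b *m b^T))) = a * \det S.
Proof.
move=> a0; transitivity (\det (block_mx 1%:M 0 (a^-1 *: b) 1%:M *m block_mx a%:M b^T 0 S)).
  rewrite mulmx_block !mul1mx !mul0mx !addr0 mul_mx_scalar scalerA mulfV ?gt_eqF //.
  by rewrite scale1r -scalemxAl addrC.
by rewrite det_mulmx det_lblock !det1 !mul1r det_ublock det_scalar1.
Qed.

Lemma cholesky n (A : 'M[R]_n) : pos_def A -> exists2 L, L \in unitmx & A = L *m L^T.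
Proof.
elim: n A => [A _|n IH A /pos_def_schur [a [b [S [a0 /IH [L uL ->] ->]]]]].
  by exists 1%:M; rewrite ?unitmx1 // [A]flatmx0 [RHS]flatmx0.
have ra : Num.sqrt a != 0 by rewrite gt_eqF // sqrtr_gt0.
have ea : Num.sqrt a * Num.sqrt a = a by rewrite -expr2 sqr_sqrtr // ltW.
exists (block_mx (Num.sqrt a)%:M 0 ((Num.sqrt a)^-1 *: b) L).
  by rewrite unitmxE (@det_lblock _ 1 n) det_scalar1 unitrM unitfE ra -unitmxE.
rewrite (@tr_block_mx _ 1 n 1 n) (@mulmx_block _ 1 n 1 n 1 n).
rewrite !trmx0 tr_scalar_mx !mul0mx !mulmx0 !addr0.
rewrite linearZ /= -scalemxAl -!scalemxAr mul_mx_scalar !mul_scalar_mx scale_scalar_mx ea.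
by rewrite mul_mx_scalar -!scalemxAl !scalerA mulVf // -invfM ea !scale1r addrC.
Qed.

Lemma pos_def_det n (A : 'M[R]_n) : pos_def A -> 0 < \det A.
Proof.
move=> /cholesky [L uL ->]; rewrite det_mulmx det_tr -expr2.
by rewrite exprn_even_gt0 //= -unitfE -unitmxE.
Qed.

Lemma pos_def_unitmx n (A : 'M[R]_n) : pos_def A -> A \in unitmx.
Proof. by move=> /pos_def_det pA; rewrite unitmxE unitfE gt_eqF. Qed.

Lemma pos_def_inv n (A : 'M[R]_n) : pos_def A -> pos_def (invmx A).
Proof.
move=> pA; have uA := pos_def_unitmx pA.
have sA := pA.1.
have := @pos_def_congr _ _ (invmx A) A; rewrite unitmx_inv => /(_ uA pA).
by rewrite trmx_inv sA mulVmx // mul1mx.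
Qed.

(* The Schur complement [S] satisfies [\tr S = \tr A - a - |b|^2 / a], so each
   step of the recursion loses exactly the off-diagonal terms. *)
Lemma det_le_expR_tr n (A : 'M[R]_n) : pos_def A ->
  \det A <= expR (\tr A - n%:R) /\ (expR (\tr A - n%:R) <= \det A -> A = 1%:M).
Proof.
elim: n A => [A _|n IH A /pos_def_schur [a [b [S [a0 pS eA]]]]].
  rewrite det_mx00 /mxtrace big_ord0 subrr expR0; split => // _.
  by rewrite [A]flatmx0 [RHS]flatmx0.
have [IH1 IH2] := IH _ pS; have dS := pos_def_det pS.
have trb : \tr (b *m b^T) = inner b b.
  by rewrite mxtrace_mulC trace_mx11 innerE /bform mulmx1.
have ineq : \tr A - n.+1%:R = (a - 1) + (\tr S - n%:R) + a^-1 * inner b b.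
  rewrite eA (@mxtrace_block _ 1 n) mxtraceD mxtraceZ trb mxtrace_scalar -natr1; ring.
have b_ge0 : 0 <= a^-1 * inner b b by rewrite mulr_ge0 ?inner_ge0 // invr_ge0 ltW.
have a_le : a <= expR (a - 1) by have := expR_ge1Dx (a - 1); rewrite addrC subrK.
have le1 : a * \det S <= expR (a - 1) * expR (\tr S - n%:R).
  by rewrite ler_pM // ltW.
have le2 : a * \det S <= expR (\tr A - n.+1%:R).
  by rewrite (le_trans le1) // ineq -expRD ler_expR lerDl.
split; first by rewrite eA det_schur // -eA.
rewrite {2}eA det_schur // ineq => h.
(* Equality case: a nonzero [b], and then [a] different from 1, would make one of the estimates
   strict. With both excluded, induction applies to [S]. *)
have b0 : b = 0.
  apply/eqP; rewrite -inner_eq0; apply: contraTT h => b0; rewrite -ltNge.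
  rewrite (le_lt_trans le1) // !expRD ltr_pMr ?mulr_gt0 ?expR_gt0 //.
  by rewrite expR_gt1 mulr_gt0 ?invr_gt0 // lt_def b0 inner_ge0.
move: h; rewrite b0 [inner _ _](_ : _ = 0); last by apply/eqP; rewrite inner_eq0.
rewrite mulr0 addr0 expRD => h.
have a1 : a = 1.
  apply/eqP; rewrite -subr_eq0; apply: contraTT h => a1; rewrite -ltNge.
  apply: (@lt_le_trans _ _ (expR (a - 1) * \det S)); last first.
    by rewrite ler_pM2l ?expR_gt0.
  by rewrite ltr_pM2r // -[X in X < _](subrK 1) addrC expR_gt1Dx.
move: h; rewrite a1 subrr expR0 !mul1r => /IH2 S1.
by rewrite eA b0 a1 S1 mul0mx scaler0 addr0 trmx0 -scalar_mx_block.
Qed.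

(** AM-GM for the eigenvalues: [s^-1 *: A] has trace at most [n], so the exponential bound puts its
    determinant below 1. *)
Lemma det_le_tr_pow n (A : 'M[R]_n) s : pos_def A -> 0 < s -> \tr A <= s * n%:R ->
  \det A <= s ^+ n.
Proof.
move=> pA s0 trA.
have pB : pos_def (s^-1 *: A).
  split; first by rewrite linearZ /= pA.1.
  move=> z z0; rewrite -[X in _ < X]/(bform _ z z) bformMZ mulr_gt0 ?invr_gt0 //.
  exact: pA.2.
have [+ _] := det_le_expR_tr pB.
rewrite detZ mxtraceZ exprVn => h.
rewrite -[leLHS](mulVKf (x := s ^+ n)) ?expf_neq0 ?gt_eqF //.
rewrite ler_piMr ?exprn_ge0 ?(ltW s0) // (le_trans h) // expR_le1 subr_le0.
by rewrite ler_pdivrMl.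
Qed.

(** The reflection along [w = y - s e0], with [s] the norm of [y], exchanges [y] and [s e0]. If
    [w = 0], the identity serves. *)
Lemma householder n (y : 'cV[R]_n.+1) : y != 0 ->
  exists (H : 'M[R]_n.+1) (s : R),
  [/\ 0 < s, H *m H^T = 1%:M & H^T *m y = s *: delta_mx 0 0].
Proof.
move=> y0; pose s := Num.sqrt (inner y y).
have y_gt0 : 0 < inner y y by rewrite lt_def inner_eq0 y0 inner_ge0.
have s0 : 0 < s by rewrite sqrtr_gt0.
have s2 : inner y y = s ^+ 2 by rewrite sqr_sqrtr // ltW.
pose e : 'cV[R]_n.+1 := delta_mx 0 0; pose w := y - s *: e.
have [w0|w0] := eqVneq w 0.
  exists 1%:M, s; split => //; first by rewrite trmx1 mulmx1.
  by rewrite trmx1 mul1mx; apply/eqP; rewrite -subr_eq0 -/w w0.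
have ww : w^T *m w = (inner w w)%:M by rewrite [LHS]mx11_scalar innerE /bform mulmx1.
have wy : w^T *m y = (inner w y)%:M by rewrite [LHS]mx11_scalar innerE /bform mulmx1.
have iw : inner w w != 0 by rewrite inner_eq0.
have iwy : inner w w = 2 * inner w y.
  rewrite !innerE /w !(bformDl, bformDr, bformNl, bformNr, bformZl, bformZr) -!innerE.
  rewrite s2 (innerC e y) !inner_delta mxE !eqxx /=; ring.
pose H : 'M[R]_n.+1 := 1%:M - (2 / inner w w) *: (w *m w^T).
have HT : H^T = H by rewrite /H linearB /= trmx1 linearZ /= trmx_mul trmxK.
exists H, s; split => //.
  rewrite HT /H mulmxBl mul1mx mulmxBr mulmx1 -scalemxAl -scalemxAr.
  rewrite (mulmxA (w *m w^T)) -(mulmxA w w^T w) ww mul_mx_scalar -!scalemxAl !scalerA.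
  by move: (w *m w^T) => W; apply/matrixP => i j; rewrite !mxE; field.
rewrite HT /H mulmxBl mul1mx -scalemxAl -mulmxA wy mul_mx_scalar scalerA.
have -> : 2 / inner w w * inner w y = 1.
  by rewrite mulrAC -iwy mulfV.
by rewrite scale1r /w subKr.
Qed.

(** A Cholesky factor followed by an orthogonal matrix. [P] maps the unit ball onto the centred
    ellipsoid of shape [A], the functional [x] becomes [s] times the first coordinate, and so [s] is
    the half-width along [x]. *)
Lemma adapted_frame n (A : 'M[R]_n.+1) (x : 'cV[R]_n.+1) : pos_def A -> x != 0 ->
  exists (P : 'M[R]_n.+1) (s : R),
  [/\ 0 < s, P \in unitmx, A = P *m P^T & P^T *m x = s *: delta_mx 0 0].
Proof.
move=> /cholesky [L uL ->] x0.
have uLT : L^T \in unitmx by rewrite unitmx_tr.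
have [|H [s [s0 HH Hx]]] := @householder _ (L^T *m x).
  by apply: contraNneq x0 => Lx; rewrite -(mulKmx uLT x) Lx mulmx0.
exists (L *m H), s; split => //; last by rewrite trmx_mul -mulmxA.
- by rewrite unitmx_mul uL; have [->] := mulmx1_unit HH.
- by rewrite trmx_mul mulmxA -(mulmxA L) HH mulmx1.
Qed.

End PositiveDefinite.

(** * The Löwner ellipsoid of a half-ellipsoid *)

Section HalfEllipsoid.
Context {R : realType} (m : nat).
Local Notation D := (m.+1%:R : R).
Local Notation e0 := (delta_mx 0 0 : 'cV[R]_m.+1).

(** For the half unit ball the Löwner ellipsoid has semi-axis [D / (D + 1)] along [e0] and squared
    semi-axes [D^2 / (D^2 - 1)] across it. [cut_shrink] is the inverse of the latter;
    [cut_shrink + cut_weight] is the inverse square of the former. *)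
Definition cut_shrink : R := 1 - (D ^+ 2)^-1.
Definition cut_weight : R := 2 * (D + 1) / D ^+ 2.

Let D1 : 1 <= D. Proof. by rewrite ler1n. Qed.
Let De : 0 < D + 1. Proof. by rewrite addr_gt0. Qed.
Let D2 : 0 <= D ^+ 2 - 1. Proof. by rewrite subr_ge0 exprn_ege1. Qed.
Let D2_gt0 : (0 < m)%N -> 0 < D ^+ 2 - 1.
Proof. by move=> m0; rewrite subr_gt0 exprn_egt1 // ltr1n. Qed.
Let D2E : D ^+ 2 - 1 = (D + 1) * m%:R. Proof. by rewrite -natr1; ring. Qed.

Lemma cut_shrink_ge0 : 0 <= cut_shrink.
Proof. by rewrite subr_ge0 invf_le1 ?exprn_gt0 // exprn_ege1. Qed.
Lemma cut_weight_ge0 : 0 <= cut_weight.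
Proof. by rewrite divr_ge0 ?sqr_ge0 // mulr_ge0 // ltW. Qed.

(** Here [B] and [q] stand for the inverse shape and centre of a competing ellipsoid, and the
    weights are the squared Löwner semi-axes. The bound is a positive combination of containment at
    [e0], containment at the points [ei] and [-ei] (averaged, so the linear term cancels), and
    nonnegativity of [B] at [e0 / (D + 1) - q], the offset from the Löwner centre. *)
Lemma contact_points_trace (B : 'M[R]_m.+1) (q : 'cV[R]_m.+1) : pos_def B ->
  (forall z, inner z z <= 1 -> 0 <= z 0 0 -> bform B (z - q) (z - q) <= 1) ->
  (D / (D + 1)) ^+ 2 * B 0 0
    + D ^+ 2 / (D ^+ 2 - 1) * \sum_(i < m) B (lift ord0 i) (lift ord0 i) <= D.
Proof.
move=> pB hB; have sB := pB.1.
pose Q := bform B q q; pose h := bform B e0 q.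
have f0 : Q <= 1.
  have := hB 0; rewrite sub0r bformNl bformNr opprK; apply; last by rewrite mxE.
  by rewrite innerE /bform mulmx0 mxE.
have fe (i : 'I_m.+1) : inner (delta_mx i 0) (delta_mx i 0 : 'cV[R]__) = 1.
  by rewrite inner_delta mxE !eqxx.
have expand (z : 'cV_m.+1) : bform B (z - q) (z - q) = bform B z z - 2 * bform B z q + Q.
  by rewrite !(bformDl, bformDr, bformNl, bformNr) (bformC q z) // -/Q; ring.
have f1 : B 0 0 - 2 * h + Q <= 1.
  by have := hB e0; rewrite expand bform_delta; apply; rewrite ?fe // mxE !eqxx.
have fi (i : 'I_m) : B (lift ord0 i) (lift ord0 i) + Q <= 1.
  pose e : 'cV[R]_m.+1 := delta_mx (lift ord0 i) 0.
  have e_0 : e 0 0 = 0 by rewrite mxE.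
  have := hB e; rewrite expand bform_delta fe e_0 => /(_ (lexx _) (lexx _)).
  have := hB (- e); rewrite expand !(bformNl, bformNr) opprK bform_delta.
  rewrite innerNl innerNr opprK fe mxE e_0 oppr0 => /(_ (lexx _) (lexx _)).
  by lra.
have fsum : \sum_(i < m) B (lift ord0 i) (lift ord0 i) <= m%:R * (1 - Q).
  rewrite -[m in m%:R]card_ord mulr_natl -sumr_const; apply: ler_sum => i _.
  by rewrite lerBrDr.
have fp : 0 <= (D + 1)^-1 ^+ 2 * B 0 0 - 2 * ((D + 1)^-1 * h) + Q.
  have := pos_def_ge0 ((D + 1)^-1 *: e0 - q) pB.
  by rewrite expand !(bformZl, bformZr) bform_delta expr2 mulrA.
have fbeta : D ^+ 2 / (D ^+ 2 - 1) * \sum_(i < m) B (lift ord0 i) (lift ord0 i)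
             <= D ^+ 2 / (D + 1) * (1 - Q).
  (* In dimension one [D^2 - 1] vanishes, but the sum is empty and [Q <= 1] suffices. *)
  have [m0|m_gt0] := posnP m.
    rewrite big1 ?mulr0; last by move=> [i im]; exfalso; rewrite m0 in im.
    by rewrite mulr_ge0 ?subr_ge0 // divr_ge0 ?sqr_ge0 ?(ltW De).
  apply: (@le_trans _ _ (D ^+ 2 / (D ^+ 2 - 1) * (m%:R * (1 - Q)))).
    by rewrite ler_wpM2l // divr_ge0 ?sqr_ge0.
  rewrite mulrA ler_wpM2r ?subr_ge0 // le_eqVlt; apply/orP; left; apply/eqP.
  by rewrite D2E; move: (D) De => z z_gt0; field; rewrite !gt_eqF ?ltr0n.
apply: le_trans (lerD (lexx _) fbeta) _.
have -> : (D / (D + 1)) ^+ 2 * B 0 0 + D ^+ 2 / (D + 1) * (1 - Q) =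
   D - D * ((D + 1)^-1 * (1 - (B 0 0 - 2 * h + Q)) +
    ((D + 1)^-1 ^+ 2 * B 0 0 - 2 * ((D + 1)^-1 * h) + Q)).
  by move: (D) De => z z_gt0; field; rewrite gt_eqF.
by rewrite gerBl mulr_ge0 // addr_ge0 // mulr_ge0 ?subr_ge0 // invr_ge0 ltW.
Qed.

(** Both factors are estimated by [1 + y <= exp y]: [D / (D + 1) = 1 - 1 / (D + 1)] gives exponent
    [- 2 / (D + 1)] after squaring, and [1 + 1 / (D^2 - 1)] to the power [m = D - 1] gives
    [1 / (D + 1)]. *)
Lemma cut_det_bound : (D / (D + 1)) ^+ 2 * (D ^+ 2 / (D ^+ 2 - 1)) ^+ m
  <= expR (- (D + 1)^-1).
Proof.
have -> : - (D + 1)^-1 = - (D + 1)^-1 * 2 + (D + 1)^-1 by ring.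
rewrite expRD; apply: ler_pM.
- by rewrite sqr_ge0.
- by apply: exprn_ge0; rewrite divr_ge0 ?sqr_ge0.
- rewrite expRM_natr ler_pXn2r ?nnegrE ?expR_ge0 ?divr_ge0 ?(ltW De) //.
  have := expR_ge1Dx (- (D + 1)^-1); apply: le_trans.
  rewrite le_eqVlt; apply/orP; left; apply/eqP.
  by move: (D) De => z z_gt0; field; rewrite gt_eqF.
have [m0|m_gt0] := posnP m.
  by rewrite [X in _ ^+ X]m0 expr0 ltW // expR_gt1 invr_gt0.
have -> : (D + 1)^-1 = (D ^+ 2 - 1)^-1 * m%:R.
  by rewrite D2E; move: (D) De => z z_gt0; field; rewrite !gt_eqF ?ltr0n.
rewrite expRM_natr ler_pXn2r ?nnegrE ?expR_ge0 ?divr_ge0 ?sqr_ge0 //.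
have := expR_ge1Dx ((D ^+ 2 - 1)^-1); apply: le_trans.
rewrite le_eqVlt; apply/orP; left; apply/eqP.
by move: (D) (D2_gt0 m_gt0) => z z_gt0; field; rewrite gt_eqF.
Qed.

(** * Coordinates in which the ellipsoid is the unit ball and the cut is orthogonal to the first
    axis *)

Variables (E : ellipsoid R m.+1) (P : 'M[R]_m.+1) (x : 'cV[R]_m.+1) (s : R).
Hypotheses (uP : P \in unitmx) (EP : eshape E = P *m P^T).
Let uPT : P^T \in unitmx. Proof. by rewrite unitmx_tr. Qed.
Hypotheses (s_gt0 : 0 < s) (Px : P^T *m x = s *: e0).

Lemma frame_inv : P^T *m invmx (eshape E) *m P = 1%:M.
Proof.
apply: (can_inj (mulKmx uP)); rewrite !mulmxA -EP mulmxV ?mul1mx ?mulmx1 //.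
by rewrite EP unitmx_mul uP uPT.
Qed.

Lemma frame_in_ell z : in_ell E (ecenter E + P *m z) <-> inner z z <= 1.
Proof.
by rewrite /in_ell addrC addKr -/(bform _ _ _) -bform_congr frame_inv innerE.
Qed.

Lemma frame_inner z :
  inner (ecenter E + P *m z) x = inner (ecenter E) x + s * z 0 0.
Proof.
by rewrite innerDl inner_trmx Px innerZr inner_delta.
Qed.

Lemma frame_coord th : exists z, th = ecenter E + P *m z.
Proof. by exists (invmx P *m (th - ecenter E)); rewrite mulKVmx // addrC subrK. Qed.

Lemma coord_le1 (z : 'cV[R]_m.+1) : inner z z <= 1 -> -1 <= z 0 0 <= 1.
Proof.
rewrite /inner big_ord_recl -expr2 -ler_norml => h.
rewrite -(@expr_le1 _ 2) // -normrX ger0_norm ?sqr_ge0 // (le_trans _ h) // lerDl.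
by apply: sumr_ge0 => k _; rewrite -expr2 sqr_ge0.
Qed.

Lemma frame_max u : is_max_lin E x u -> u = inner (ecenter E) x + s.
Proof.
move=> [[th [Eth <-]] mx]; apply/eqP; rewrite eq_le; apply/andP; split.
  have [z Dth] := frame_coord th; move: Eth; rewrite Dth frame_in_ell frame_inner => z1.
  by rewrite lerD2l ler_piMr ?(ltW s_gt0) //; case/andP: (coord_le1 z1).
have := mx (ecenter E + P *m e0); rewrite frame_in_ell frame_inner.
by rewrite inner_delta mxE !eqxx mulr1; apply.
Qed.

Lemma frame_min u : is_min_lin E x u -> u = inner (ecenter E) x - s.
Proof.
move=> [[th [Eth <-]] mx]; apply/eqP; rewrite eq_le; apply/andP; split; last first.
  have [z Dth] := frame_coord th; move: Eth; rewrite Dth frame_in_ell frame_inner => z1.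
  by rewrite lerD2l -mulrN1 ler_pM2l //; case/andP: (coord_le1 z1).
have := mx (ecenter E + P *m - e0); rewrite frame_in_ell frame_inner.
rewrite innerNl innerNr opprK inner_delta !mxE !eqxx mulrN1.
by apply.
Qed.

(* Any ellipsoid containing the half-ellipsoid contains, in the frame [P], the
   points [e0] and [+-ei], which are the contact points of the Löwner ellipsoid.
   Hence [M = Q^T A'^-1 Q] has trace at most [m+1], where [Q Q^T] is the Löwner
   shape; minimality of the volume gives [\det M >= 1], so that [M = 1]. *)
Lemma mvee_half (K : 'cV[R]_m.+1 -> Prop) (E' : ellipsoid R m.+1) :
  (forall th, K th <-> in_ell E th /\ inner (ecenter E) x <= inner th x) ->
  is_mvee K E' ->
  invmx (eshape E') = cut_shrink *: invmx (eshape E)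
                      + (cut_weight / s ^+ 2) *: (x *m x^T)
  /\ \det (eshape E') <= \det (eshape E) * expR (- (D + 1)^-1).
Proof.
move=> hK [pE' [KE' minE']].
pose beta2 := D ^+ 2 / (D ^+ 2 - 1).
have beta2_ge0 : 0 <= beta2 by rewrite divr_ge0 ?sqr_ge0.
(* The index only witnesses [0 < m]; for [m = 0], [beta2] is 0 by the convention on division, and no
   semi-axis uses it. *)
have beta2_gt0 (i : 'I_m) : 0 < beta2.
  have m_gt0 : (0 < m)%N by rewrite (leq_ltn_trans _ (ltn_ord i)).
  by rewrite divr_gt0 ?D2_gt0 // exprn_gt0.
pose wt (i : 'I_m.+1) := if i == 0 then D / (D + 1) else Num.sqrt beta2.
have wt0 i : wt i != 0.
  rewrite /wt; case: (unliftP ord0 i) => [j ->|->] /=.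
    by rewrite gt_eqF // sqrtr_gt0 (beta2_gt0 j).
  by rewrite mulf_neq0 ?invr_neq0 // gt_eqF //; lra.
have wt2 i : wt (lift ord0 i) ^+ 2 = beta2 by rewrite /wt /= sqr_sqrtr.
pose W := diag_mx (\row_i wt i).
have WT : W^T = W by rewrite tr_diag_mx.
have uW : W \in unitmx.
  by rewrite unitmxE det_diag unitfE; apply/prodf_neq0 => i _; rewrite mxE.
have detW : \det W ^+ 2 = (D / (D + 1)) ^+ 2 * beta2 ^+ m.
  rewrite det_diag big_ord_recl exprMn mxE /=; congr (_ * _).
  by rewrite -prodrXl -[m in _ ^+ m]card_ord -prodr_const; apply: eq_bigr => i _; rewrite mxE wt2.
pose Q := P *m W.
have uQ : Q \in unitmx by rewrite unitmx_mul uP.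
(* [N] is the claimed inverse shape; [Q] carries the frame rescaled by the Löwner semi-axes, in
   which [N] becomes the identity. *)
pose N := cut_shrink *: invmx (eshape E) + (cut_weight / s ^+ 2) *: (x *m x^T).
have QN : Q^T *m N *m Q = 1%:M.
  have PN : P^T *m N *m P = cut_shrink *: 1%:M + cut_weight *: delta_mx 0 0.
    rewrite /N mulmxDr mulmxDl -!scalemxAr -!scalemxAl frame_inv mulmxA.
    rewrite Px -(mulmxA (s *: e0)) -[x^T *m P]trmxK trmx_mul trmxK Px linearZ /=.
    rewrite -scalemxAl -scalemxAr !scalerA trmx_delta mul_delta_mx.
    by congr (_ + _ *: _); move: cut_weight => w; field; rewrite gt_eqF.
  have -> : Q^T *m N *m Q = W *m (P^T *m N *m P) *m W by rewrite trmx_mul WT !mulmxA.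
  apply/matrixP => i j; rewrite PN mul_mx_diag mxE mul_diag_mx !mxE.
  have [<-|ij] := eqVneq i j; last first.
    rewrite [(i == 0) && _](_ : _ = false) ?mulr0 ?addr0 ?mulr0 ?mul0r //.
    by apply/negbTE; apply: contra ij => /andP[/eqP-> /eqP->].
  rewrite andbb mulrAC -expr2; case: (unliftP ord0 i) => [k ->|->].
    rewrite wt2 /= mulr0 addr0 mulr1 /beta2 /cut_shrink.
    move: (D) D1 (D2_gt0 (leq_ltn_trans (leq0n k) (ltn_ord k))) => z z1 z_gt0.
    by field; rewrite !gt_eqF // (lt_le_trans _ z1).
  rewrite /wt /= !mulr1 /cut_shrink /cut_weight.
  by move: (D) De D1 => z z0 z1; field; rewrite !gt_eqF // (lt_le_trans _ z1).
have invQ : invmx (Q *m Q^T) = N.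
  apply: (can_inj (mulKmx (_ : Q^T \in unitmx))); first by rewrite unitmx_tr.
  apply: (can_inj (mulmxK uQ)); rewrite QN -mulmxA.
  have uQQ : Q *m Q^T \in unitmx by rewrite unitmx_mul uQ unitmx_tr.
  apply: (can_inj (mulKmx uQ)).
  by rewrite !mulmxA mulmxV // mul1mx mulmx1.
pose E0 := Ell (ecenter E + P *m ((D + 1)^-1 *: e0)) (Q *m Q^T).
have ellE0 : is_ellipsoid E0.
  rewrite /is_ellipsoid /= -[Q in Q *m _]trmxK -[X in X *m _]mulmx1.
  by apply: pos_def_congr pos_def1; rewrite unitmx_tr.
have KE0 th : K th -> in_ell E0 th.
  move=> /hK; have [z ->] := frame_coord th.
  rewrite frame_in_ell frame_inner lerDl => -[z1]; rewrite pmulr_rge0 // => z0.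
  rewrite /in_ell /= invQ -/(bform _ _ _) opprD addrACA subrr add0r -mulmxBr.
  have zz : z 0 0 <= 1 by case/andP: (coord_le1 z1).
  set w := z - _; rewrite bformMD !bformMZ -bform_congr frame_inv bform_outer -innerE.
  rewrite inner_trmx Px innerZr inner_delta.
  rewrite (_ : inner w w = inner z z - 2 * (D + 1)^-1 * z 0 0 + (D + 1)^-1 ^+ 2); last first.
    rewrite /w !(innerDl, innerDr, innerNl, innerNr, innerZl, innerZr) (innerC e0 z).
    by rewrite !inner_delta mxE !eqxx /=; ring.
  rewrite !mxE !eqxx mulr1 -subr_ge0.
  (* The slack in the containment is a nonnegative combination of the constraints [|z| <= 1] and
     [0 <= z0 <= 1] that describe the half-ball. *)
  rewrite [X in 0 <= X](_ : _ = cut_shrink * (1 - inner z z)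
                                + cut_weight * (z 0 0 * (1 - z 0 0))).
    move: cut_shrink cut_weight cut_shrink_ge0 cut_weight_ge0 => k l k0 l0.
    by rewrite addr_ge0 ?mulr_ge0 ?subr_ge0.
  rewrite /cut_shrink /cut_weight; move: (D) De D1 => c c0 c1.
  by field; rewrite !gt_eqF // (lt_le_trans _ c1).
have detE0 : \det (eshape E0) = \det (eshape E) * \det W ^+ 2.
  by rewrite /= EP !det_mulmx !det_tr det_mulmx; ring.
have detle := minE' _ ellE0 KE0; rewrite detE0 in detle.
split; last first.
  apply: le_trans detle _; rewrite detW ler_wpM2l ?cut_det_bound //.
  by rewrite EP det_mulmx det_tr -expr2 sqr_ge0.
pose B := P^T *m invmx (eshape E') *m P.
have pB : pos_def B by apply: pos_def_congr => //; apply: pos_def_inv.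
have BQ : Q^T *m invmx (eshape E') *m Q = W *m B *m W.
  by rewrite /Q trmx_mul WT /B !mulmxA.
have pM : pos_def (Q^T *m invmx (eshape E') *m Q).
  by apply: pos_def_congr => //; apply: pos_def_inv.
have trM : \tr (Q^T *m invmx (eshape E') *m Q) <= D.
  have [q Dq] := frame_coord (ecenter E').
  have := @contact_points_trace B q pB; rewrite BQ => h.
  apply: le_trans (h _).
    rewrite /mxtrace big_ord_recl mulr_sumr le_eqVlt; apply/orP; left; apply/eqP.
    congr (_ + _); first by rewrite mul_mx_diag mul_diag_mx !mxE /wt /=; ring.
    apply: eq_bigr => i _; rewrite -/beta2 -(wt2 i) mul_mx_diag mul_diag_mx !mxE; ring.
  move=> z z1 z0; have : K (ecenter E + P *m z).
    by apply/hK; rewrite frame_in_ell frame_inner lerDl pmulr_rge0.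
  move=> /KE'; rewrite /in_ell -/(bform _ _ _) Dq opprD addrACA subrr add0r -mulmxBr.
  by rewrite -bform_congr.
have detM : 1 <= \det (Q^T *m invmx (eshape E') *m Q).
  rewrite (_ : \det _ = \det (eshape E) * \det W ^+ 2 / \det (eshape E')).
    by rewrite ler_pdivlMr ?mul1r // pos_def_det.
  by rewrite /Q EP !det_mulmx det_tr det_inv !det_mulmx det_tr; ring.
have [_ M1] := det_le_expR_tr pM.
have {}M1 : Q^T *m invmx (eshape E') *m Q = 1%:M.
  by apply: M1; apply: le_trans detM; rewrite expR_le1 subr_le0.
have := M1; rewrite -QN => /(can_inj (mulmxK uQ)).
by apply: (can_inj (mulKmx _)); rewrite unitmx_tr.
Qed.

End HalfEllipsoid.

(** * One search step: trace invariant and volume loss *)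

Section EllipsoidSearch.
Context {R : realType}.

(** The trace bound keeps every semi-axis from becoming too short. Its value is the fixed point of
    [t -> (1 - 1/d^2) t + 2 (d+1)/d^2 * 4/delta^2], which bounds the trace after a cut of half-width
    above [delta / 2]. *)
Definition search_invariant d (delta : R) (th : 'cV[R]_d) (E : ellipsoid R d) : Prop :=
  [/\ is_ellipsoid E, in_ell E th &
      \tr (invmx (eshape E)) <= 8 * (d%:R + 1) / delta ^+ 2].

Lemma unit_ell_invariant d delta (th : 'cV[R]_d) : 0 < delta <= 1 -> in_ball th ->
  search_invariant delta th (unit_ell R d).
Proof.
move=> /andP[d0 d1] Bth; split; first exact: pos_def1.
  by rewrite /in_ell /= subr0 invmx1 -/(bform _ _ _) -innerE.
rewrite /= invmx1 mxtrace1 ler_pdivlMr ?exprn_gt0 //.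
have dR : 0 <= d%:R :> R by [].
have d2 : delta ^+ 2 <= 1 by rewrite expr_le1 // ltW.
apply: (@le_trans _ _ d%:R); first by rewrite ler_piMr.
by move: d%:R dR => c c0; lra.
Qed.

Lemma search_invariant_ln_det d delta (th : 'cV[R]_d) E : (0 < d)%N -> 0 < delta ->
  search_invariant delta th E -> - ln (\det (eshape E)) <= d%:R * ln (16 / delta ^+ 2).
Proof.
move=> d0 delta0 [pE _ trE].
have k0 : 0 < 16 / delta ^+ 2 by rewrite divr_gt0 // exprn_gt0.
have dE : 0 < \det (eshape E) by apply: pos_def_det.
have pI : pos_def (invmx (eshape E)) by apply: pos_def_inv.
have h : \det (invmx (eshape E)) <= (16 / delta ^+ 2) ^+ d.
  apply: det_le_tr_pow => //; apply: (le_trans trE).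
  rewrite [leRHS]mulrAC ler_pM2r ?invr_gt0 ?exprn_gt0 //.
  (* Uses [d + 1 <= 2 d], whence the constant 16. *)
  have : 1 <= d%:R :> R by rewrite ler1n.
  by move: d%:R => c c0; lra.
rewrite -lnV ?posrE // -det_inv mulr_natl -lnXn // ler_ln ?posrE //.
  by rewrite det_inv invr_gt0.
by rewrite exprn_gt0.
Qed.

(** The posted price is the midpoint of the range, so the cut passes through the centre and
    [mvee_half] gives both the new shape and the determinant drop. *)
Lemma search_step d delta (th x : 'cV[R]_d) (E E' : ellipsoid R d) U L K :
  0 < delta -> search_invariant delta th E -> inner x x <= 1 ->
  is_max_lin E x U -> is_min_lin E x L -> delta < U - L ->
  (forall th', K th' <-> in_ell E th' /\ (U + L) / 2 <= inner th' x) \/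
  (forall th', K th' <-> in_ell E th' /\ inner th' x <= (U + L) / 2) ->
  K th -> is_mvee K E' ->
  search_invariant delta th E'
  /\ - ln (\det (eshape E)) + (d%:R + 1)^-1 <= - ln (\det (eshape E')).
Proof.
move=> delta0 [pE Eth trE] x1 mU mL wide hK Kth mvee.
have x0 : x != 0.
  apply: contraTneq wide => x0; move: mU mL => [[u [_ <-]] _] [[l [_ <-]] _].
  by rewrite x0 -(scale0r 0) !innerZr !mul0r subrr -leNgt ltW.
case: d => [|m] in th x E E' K pE Eth trE x1 mU mL hK Kth mvee x0 *.
  by rewrite [x]flatmx0 eqxx in x0.
have [P [s [s0 uP EP Px]]] := adapted_frame pE x0.
have Umax := frame_max uP EP s0 Px mU; have Lmin := frame_min uP EP s0 Px mL.
have mid : (U + L) / 2 = inner (ecenter E) x by rewrite Umax Lmin; field.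
have s_wide : delta < 2 * s by move: wide; rewrite Umax Lmin; lra.
have trN p q (M : 'M[R]_(p, q)) : (- M)^T = - M^T by apply/matrixP => i j; rewrite !mxE.
have [shape' det'] :
    invmx (eshape E') = cut_shrink m *: invmx (eshape E)
                        + (cut_weight m / s ^+ 2) *: (x *m x^T)
    /\ \det (eshape E') <= \det (eshape E) * expR (- (m.+1%:R + 1)^-1).
  case: hK => hK.
    by apply: (mvee_half uP EP s0 Px _ mvee) => th'; rewrite -mid hK.
  (* The opposite half-space reduces to the first by negating [x] and [P], which changes neither
     [x x^T] nor [P P^T]. *)
  have xx : x *m x^T = - x *m (- x)^T by rewrite trN mulNmx mulmxN opprK.
  rewrite xx.
  apply: (@mvee_half _ _ E (- P) (- x) s _ _ s0 _ K) => //.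
  - by rewrite -scaleN1r unitmxZ ?unitrN1.
  - by rewrite trN mulNmx mulmxN opprK.
  - by rewrite trN mulNmx mulmxN opprK.
  - by move=> th'; rewrite hK mid !innerNr lerN2.
have pE' : is_ellipsoid E' by have [] := mvee.
have dE : 0 < \det (eshape E) by apply: pos_def_det.
have dE' : 0 < \det (eshape E') by apply: pos_def_det.
split; last first.
  have : ln (\det (eshape E')) <= ln (\det (eshape E) * expR (- (m.+1%:R + 1)^-1)).
    by rewrite ler_ln ?posrE // mulr_gt0 // expR_gt0.
  by rewrite lnM ?posrE ?expR_gt0 // expRK; lra.
split => //; first by have [_ [+ _]] := mvee; apply.
have trx : \tr (x *m x^T) = inner x x.
  by rewrite mxtrace_mulC trace_mx11 innerE /bform mulmx1.
rewrite shape' mxtraceD !mxtraceZ trx.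
have D0 : 0 < m.+1%:R :> R by [].
have w0 : 0 <= cut_weight m / s ^+ 2 :> R.
  by rewrite divr_ge0 ?sqr_ge0 ?cut_weight_ge0.
have s2 : (s ^+ 2)^-1 <= 4 / delta ^+ 2.
  rewrite -[leRHS]invf_div lef_pV2 ?posrE ?divr_gt0 ?exprn_gt0 //.
  rewrite ler_pdivrMr // (_ : s ^+ 2 * 4 = (2 * s) ^+ 2); last by ring.
  by rewrite ler_pXn2r ?nnegrE ?mulr_ge0 ?(ltW s0) ?(ltW delta0) ?(ltW s_wide).
apply: le_trans (lerD (ler_wpM2l (cut_shrink_ge0 m) trE) (ler_wpM2l w0 x1)) _.
rewrite mulr1; apply: le_trans (lerD (lexx _) (ler_wpM2l (cut_weight_ge0 m) s2)) _.
(* Equality, because the invariant is the fixed point of the trace recursion. *)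
rewrite /cut_shrink /cut_weight le_eqVlt; apply/orP; left; apply/eqP.
by move: m.+1%:R D0 => c c0; field; rewrite !gt_eqF.
Qed.

End EllipsoidSearch.

(** * Matchings and the regret of a single round *)

Section Market.
Context {R : realType} {n : nat}.
Implicit Types (c v : 'I_n -> R) (M : {set 'I_n * 'I_n}).

Lemma matching_fst_inj M : matching M -> {in M &, injective fst}.
Proof.
move=> /forall_inP mM e1 e2 M1 M2 e12; apply/eqP.
by move/forall_inP/(_ e2 M2): (mM e1 M1); rewrite e12 eqxx.
Qed.

Lemma matching_snd_inj M : matching M -> {in M &, injective snd}.
Proof.
move=> /forall_inP mM e1 e2 M1 M2 e12; apply/eqP.
by move/forall_inP/(_ e2 M2): (mM e1 M1); rewrite e12 eqxx orbT.
Qed.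

Lemma card_matching M : matching M -> (#|M| <= n)%N.
Proof.
move=> /matching_fst_inj /card_in_imset <-.
by rewrite -[leqRHS]card_ord max_card.
Qed.

(** Only the sets of matched traders matter, so the two sides of the market can be compared
    separately. *)
Lemma gftE c v M : matching M ->
  gft c v M = \sum_(j in [set e.2 | e in M]) v j - \sum_(i in [set e.1 | e in M]) c i.
Proof.
move=> mM; rewrite !big_imset; first exact: sumrB.
- exact: matching_fst_inj.
- exact: matching_snd_inj.
Qed.

Lemma sum_le_support (f : 'I_n -> R) (A S : {set 'I_n}) : (forall i, 0 <= f i) ->
  (forall i, i \in A -> i \notin S -> f i = 0) -> \sum_(i in A) f i <= \sum_(i in S) f i.
Proof.
move=> f0 fAS; rewrite !(big_mkcond (fun i => i \in _)) /=; apply: ler_sum => i _.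
by case: ifPn => iA; case: ifPn => iS //; rewrite fAS.
Qed.

(** [w] is a reference level between the worst outcome and the benchmark. The first hypothesis
    handles the default 0 of the maximum, and the third ensures [w <= opt_gft], the default of the
    minimum. *)
Lemma round_regret_le ps pb c v (b w : R) : 0 <= b + w ->
  (forall M, matching M -> gft c v M <= b + w) ->
  (exists2 M, matching M & w <= gft c v M) \/ w <= 0 ->
  (forall M, maxcard_acc ps pb c v M -> w <= gft c v M) ->
  round_regret ps pb c v <= b.
Proof.
move=> bw0 hub hopt hw.
have opt_le : opt_gft c v <= b + w by apply: bigmax_le.
have opt_ge : w <= opt_gft c v.
  case: hopt => [[M mM wM]|w0]; first by apply: le_trans wM _; apply: le_bigmax_cond.
  by apply: le_trans w0 _; apply: bigmax_ge_id.
have worst_ge : w <= worst_gft ps pb c v by apply/bigmin_geP.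
by rewrite /round_regret; lra.
Qed.

Lemma explore_regret (p : R) ps pb c v :
  (forall i, 0 <= c i <= 1) -> (forall j, 0 <= v j <= 1) ->
  (forall k, ps k = p) -> (forall k, pb k = p) -> round_regret ps pb c v <= n%:R.
Proof.
move=> c01 v01 psp pbp; apply: (@round_regret_le _ _ _ _ _ 0); rewrite ?addr0 //.
- move=> M mM; apply: (@le_trans _ _ (\sum_(e in M) 1)).
    apply: ler_sum => e _; have := c01 e.1; have := v01 e.2; lra.
  by rewrite sumr_const ler_nat card_matching.
- by right.
move=> M /andP[/andP[_ /forall_inP accM] _]; apply: sumr_ge0 => e /accM.
by rewrite psp pbp => /andP[]; lra.
Qed.

(* Traders outside the benchmark matching accept their extreme price only with
   cost exactly 0 or value exactly 1, so swapping them in never lowers the GFT. *)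
Lemma exploit_regret (delta : R) ps pb c v cU vL M :
  (forall i, 0 <= c i <= 1) -> (forall j, 0 <= v j <= 1) ->
  (forall i, c i <= cU i <= c i + delta) -> (forall j, v j - delta <= vL j <= v j) ->
  0 <= delta -> matching M -> (forall M', matching M' -> gft cU vL M' <= gft cU vL M) ->
  (forall k, ps k = if k \in [set e.1 | e in M]
                    then \big[Num.max/cU k]_(i in [set e.1 | e in M]) cU i else 0) ->
  (forall k, pb k = if k \in [set e.2 | e in M]
                    then \big[Num.min/vL k]_(j in [set e.2 | e in M]) vL j else 1) ->
  round_regret ps pb c v <= n%:R * (2 * delta).
Proof.
move=> c01 v01 cUb vLb delta0 mM optM psE pbE.
set S1 := [set e.1 | e in M] in psE; set B1 := [set e.2 | e in M] in pbE.
have gft_lower M' : gft cU vL M' <= gft c v M'.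
  by apply: ler_sum => e _; have := cUb e.1; have := vLb e.2; lra.
(* Replacing true costs and values by the pessimistic bounds loses at most [2 * delta] per edge, and
   [M] is optimal for those bounds. *)
have gft_upper M' : matching M' -> gft c v M' <= n%:R * (2 * delta) + gft c v M.
  move=> mM'; apply: le_trans (lerD (lexx _) (gft_lower M)).
  apply: le_trans (lerD (lexx _) (optM _ mM')).
  rewrite -lerBlDr -sumrB; apply: (@le_trans _ _ (\sum_(e in M') 2 * delta)).
    by apply: ler_sum => e _; have := cUb e.1; have := vLb e.2; lra.
  rewrite sumr_const -[_ *+ #|M'|]mulr_natl ler_wpM2r ?ler_nat ?card_matching //.
  by rewrite mulr_ge0.
apply: (@round_regret_le _ _ _ _ _ (gft c v M)) => //.
- have : matching (set0 : {set 'I_n * 'I_n}) by apply/forall_inP => e; rewrite inE.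
  by move=> /gft_upper; rewrite {1}/gft big_set0.
- by left; exists M.
have accM : acc_matching ps pb c v M.
  rewrite /acc_matching mM; apply/forall_inP => e eM; apply/andP; split.
    have eS : e.1 \in S1 by apply/imsetP; exists e.
    rewrite psE eS; apply: le_trans (le_bigmax_cond _ _ eS).
    by case/andP: (cUb e.1).
  have eB : e.2 \in B1 by apply/imsetP; exists e.
  rewrite pbE eB; apply: le_trans (bigmin_le_cond _ _ eB) _.
  by case/andP: (vLb e.2).
move=> M' /andP[/andP[mM' /forall_inP accM'] /forallP/(_ M)/implyP/(_ accM) cardM].
rewrite !gftE //; apply: lerB; last first.
  apply: sum_le_support => [i|i /imsetP[e eM ->] eS]; first by case/andP: (c01 i).
  have /andP[+ _] := accM' e eM; rewrite psE (negbTE eS).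
  by have := c01 e.1; lra.
(* [M] is acceptable, so [M'] is at least as large. Writing [v = 1 - (1 - v)] splits the buyers'
   side into this count and a sum of [1 - v], which vanishes for buyers outside [B1] just as costs
   do outside [S1]. *)
have /lerB : #|B1|%:R <= #|[set e.2 | e in M']|%:R :> R.
  by rewrite ler_nat !card_in_imset //; apply: matching_snd_inj.
have sumv (A : {set 'I_n}) : \sum_(j in A) v j = #|A|%:R - \sum_(j in A) (1 - v j).
  by rewrite sumrB sumr_const opprB addrC subrK.
rewrite !sumv; apply.
apply: sum_le_support => [i|i /imsetP[e eM ->] eB]; first by have := v01 i; lra.
have /andP[_ +] := accM' e eM; rewrite pbE (negbTE eB).
by have := v01 e.2; lra.
Qed.

End Market.

(** * Amortising regret against the volume potential *)

Section Search.
Context {R : realType} {n d : nat}.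

(** Twice the total logarithmic volume lost relative to unit balls, hence 0 initially. *)
Definition log_volume_loss (F : 'I_n -> ellipsoid R d) : R :=
  \sum_i - ln (\det (eshape (F i))).

Lemma log_volume_loss_step (F F' : 'I_n -> ellipsoid R d) i e :
  (forall k, k != i -> F' k = F k) ->
  - ln (\det (eshape (F i))) + e <= - ln (\det (eshape (F' i))) ->
  log_volume_loss F + e <= log_volume_loss F'.
Proof.
move=> FF' h; rewrite /log_volume_loss (bigD1 i) // [leRHS](bigD1 i) //= addrAC.
by rewrite lerD //; apply: ler_sum => k /FF' ->.
Qed.

(** A search round raises the potential by at least [1 / (d+1)], so [n (d+1)] times the increase
    pays for its regret [n]. A segmented-price round leaves the potential unchanged and is paid for
    by the last term. *)
Lemma alg_round_regret (delta : R) thS thB (xt : 'cV[R]_d)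
    (ES EB ES' EB' : 'I_n -> ellipsoid R d) ps pb :
  0 < delta -> in_ball xt ->
  (forall i, 0 <= inner (thS i) xt <= 1) -> (forall j, 0 <= inner (thB j) xt <= 1) ->
  (forall i, search_invariant delta (thS i) (ES i)) ->
  (forall j, search_invariant delta (thB j) (EB j)) ->
  alg_round delta thS thB xt ES EB ES' EB' ps pb ->
  [/\ forall i, search_invariant delta (thS i) (ES' i),
      forall j, search_invariant delta (thB j) (EB' j) &
      round_regret ps pb (fun i => inner (thS i) xt) (fun j => inner (thB j) xt)
      <= n%:R * (d%:R + 1) * (log_volume_loss ES' + log_volume_loss EB'
                              - (log_volume_loss ES + log_volume_loss EB))
         + n%:R * (2 * delta)].
Proof.
move=> delta0 x1 c01 v01 invS invB [cU [cL [vU [vL [mc [mv alg]]]]]].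
have cost i : cL i <= inner (thS i) xt <= cU i.
  by have [_ Eth _] := invS i; have [[_ ->] // [_ ->]] := mc i.
have value j : vL j <= inner (thB j) xt <= vU j.
  by have [_ Eth _] := invB j; have [[_ ->] // [_ ->]] := mv j.
have explore r (l : R) : r <= n%:R -> (d%:R + 1)^-1 <= l ->
    r <= n%:R * (d%:R + 1) * l + n%:R * (2 * delta).
  move=> rn hl; apply: le_trans rn _; rewrite -[leLHS]addr0; apply: lerD.
    by rewrite -mulrA ler_peMr // -ler_pdivrMl ?mulr1 // ltr_wpDl.
  by rewrite !mulr_ge0 // ltW.
case: alg => [[i [wide /= [psp [pbp [-> [ES'E mvee]]]]]]
  |[_ [j [wide /= [psp [pbp [-> [EB'E mvee]]]]]]]|].
- have [inv' loss] : search_invariant delta (thS i) (ES' i) /\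
    - ln (\det (eshape (ES i))) + (d%:R + 1)^-1 <= - ln (\det (eshape (ES' i))).
    have [m M] := mc i; apply: (search_step delta0 (invS i) x1 m M wide _ _ mvee).
      by case: (inner _ _ <= _); [right|left].
    by split; [have [] := invS i | case: leP => // /ltW].
  split => //; first by move=> k; have [->|/ES'E ->] := eqVneq k i.
  apply: explore; first exact: explore_regret psp pbp.
  by have := log_volume_loss_step ES'E loss; lra.
- have [inv' loss] : search_invariant delta (thB j) (EB' j) /\
    - ln (\det (eshape (EB j))) + (d%:R + 1)^-1 <= - ln (\det (eshape (EB' j))).
    have [m M] := mv j; apply: (search_step delta0 (invB j) x1 m M wide _ _ mvee).
      by case: (_ <= inner _ _); [left|right].
    by split; [have [] := invB j | case: leP => // /ltW].
  split => //; first by move=> k; have [->|/EB'E ->] := eqVneq k j.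
  apply: explore; first exact: explore_regret psp pbp.
  by have := log_volume_loss_step EB'E loss; lra.
move=> [nc nv -> -> [M [mM optM psE pbE]]]; split => //.
rewrite subrr mulr0 add0r; apply: (exploit_regret c01 v01 _ _ _ mM optM psE pbE).
- by move=> i; have := cost i; have := nc i; lra.
- by move=> j; have := value j; have := nv j; lra.
- exact: ltW.
Qed.

End Search.

(** * Dimension zero, logarithmic estimates and summation over rounds *)

Lemma round_regret_dim0 (R : realType) n ps pb (thS thB : 'I_n -> 'cV[R]_0) x :
  round_regret ps pb (fun i => inner (thS i) x) (fun j => inner (thB j) x) = 0.
Proof.
have z (u : 'cV[R]_0) : inner u x = 0 by rewrite /inner big_ord0.
have gft0 (M : {set 'I_n * 'I_n}) :
    gft (fun i => inner (thS i) x) (fun j => inner (thB j) x) M = 0.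
  by apply: big1 => e _; rewrite !z subrr.
have opt0 : opt_gft (fun i => inner (thS i) x) (fun j => inner (thB j) x) = 0.
  apply/eqP; rewrite eq_le bigmax_ge_id andbT.
  by apply: bigmax_le => // M _; rewrite gft0.
apply/eqP; rewrite /round_regret opt0 sub0r oppr_eq0 eq_le; apply/andP; split.
  by rewrite /worst_gft opt0; apply: bigmin_le_id.
by apply/bigmin_geP; rewrite opt0; split => // M _; rewrite gft0.
Qed.

(** Inverting [1 - 1/2 <= exp (- 1/2)] gives [exp (1/2) <= 2]. The bound lets terms free of [T] be
    absorbed into [ln T]. *)
Lemma ln_ge_half (R : realType) (T : nat) : (2 <= T)%N -> 1 / 2 <= ln (T%:R : R).
Proof.
move=> T2; rewrite -ler_expR lnK ?posrE ?ltr0n ?(ltn_trans _ T2) //.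
apply: (@le_trans _ _ 2); last by rewrite ler_nat.
have := expR_ge1Dx (- (1 / 2) : R); rewrite expRN.
have := expR_gt0 (1 / 2 : R); move: (expR _) => e e0 h.
have : e * (1 - 1 / 2) <= e * e^-1 by rewrite ler_pM2l.
by rewrite mulfV ?gt_eqF //; lra.
Qed.

(** [16 <= T^4] turns [16 T^2] into at most [T^6]. *)
Lemma ln_16_sqr_le (R : realType) (T : nat) : (2 <= T)%N ->
  ln (16 / (T%:R^-1) ^+ 2) <= 6 * ln (T%:R : R).
Proof.
move=> T2; have T0 : 0 < T%:R :> R by rewrite ltr0n (ltn_trans _ T2).
rewrite [leRHS]mulr_natl -lnXn // exprVn invrK ler_ln ?posrE ?mulr_gt0 ?exprn_gt0 //.
rewrite (exprD _ 4 2) ler_pM2r ?exprn_gt0 // -natrX ler_nat.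
by rewrite (@leq_exp2r 2 T 4).
Qed.

Theorem theorem5p7 :
  exists C : nat,
  forall (R : realType) (n d T : nat), (2 <= T)%N ->
  forall (thS thB : 'I_n -> 'cV[R]_d) (x : nat -> 'cV[R]_d),
    (forall i, in_ball (thS i)) -> (forall j, in_ball (thB j)) ->
    (forall t, (1 <= t <= T)%N -> in_ball (x t)) ->
    (forall t i, (1 <= t <= T)%N -> 0 <= inner (thS i) (x t) <= 1) ->
    (forall t j, (1 <= t <= T)%N -> 0 <= inner (thB j) (x t) <= 1) ->
  forall (ES EB : nat -> 'I_n -> ellipsoid R d) (ps pb : nat -> 'I_n -> R),
    (forall i, ES 1%N i = unit_ell R d) -> (forall j, EB 1%N j = unit_ell R d) ->
    (forall t, (1 <= t <= T)%N ->
       alg_round (T%:R)^-1 thS thB (x t) (ES t) (EB t) (ES t.+1) (EB t.+1)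
                 (ps t) (pb t)) ->
    \sum_(1 <= t < T.+1)
       round_regret (ps t) (pb t) (fun i => inner (thS i) (x t))
                    (fun j => inner (thB j) (x t))
    <= C%:R * (n ^ 2)%:R * (d ^ 2)%:R * ln (T%:R : R).
Proof.
(* The constant is 24 + 4: search rounds cost at most [n * 2d * 2 * (n * d * 6 ln T)], and the
   remaining [2 n] is at most [4 n^2 d^2 ln T]. *)
exists 28%N => R n d T T2 thS thB x BS BB Bx c01 v01 ES EB ps pb ES1 EB1 alg.
have lnT := ln_ge_half R T2.
have T0 : 0 < T%:R :> R by rewrite ltr0n (ltn_trans _ T2).
have [d0|d_gt0] := posnP d.
  move: thS thB x {BS BB Bx c01 v01 ES EB ES1 EB1 alg}; rewrite d0 => thS thB x.
  by rewrite big1 ?mulr0 ?mul0r // => t _; apply: round_regret_dim0.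
set delta := T%:R^-1 in alg.
have delta01 : 0 < delta <= 1.
  by rewrite invr_gt0 T0 invf_le1 // ler1n (ltn_trans _ T2).
have [delta0 _] := andP delta01.
(* The potential telescopes over the first [k] rounds; rounds start at 1, so the state after them
   has index [k.+1]. *)
have run k : (k <= T)%N ->
  [/\ forall i, search_invariant delta (thS i) (ES k.+1 i),
      forall j, search_invariant delta (thB j) (EB k.+1 j) &
      \sum_(1 <= t < k.+1) round_regret (ps t) (pb t) (fun i => inner (thS i) (x t))
                    (fun j => inner (thB j) (x t))
      <= n%:R * (d%:R + 1) * (log_volume_loss (ES k.+1) + log_volume_loss (EB k.+1))
         + k%:R * (n%:R * (2 * delta))].
  elim: k => [_|k IH kT].
    split => [i|j|]; rewrite ?ES1 ?EB1; try exact: unit_ell_invariant.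
    rewrite big_geq // mul0r addr0 /log_volume_loss !big1 ?addr0 ?mulr0 // => i _.
      by rewrite EB1 det1 ln1 oppr0.
    by rewrite ES1 det1 ln1 oppr0.
  have [invS invB sum_le] := IH (ltnW kT).
  have kT' : (1 <= k.+1 <= T)%N by [].
  have [invS' invB' reg] := alg_round_regret delta0 (Bx _ kT') (fun i => c01 _ i kT')
    (fun j => v01 _ j kT') invS invB (alg _ kT').
  split => //; rewrite big_nat_recr //=; apply: le_trans (lerD sum_le reg) _.
  by rewrite -[k.+1%:R]natr1 le_eqVlt; apply/orP; left; apply/eqP; ring.
have [invS invB sum_le] := run T (leqnn T).
have loss_le (th : 'I_n -> 'cV[R]_d) F : (forall i, search_invariant delta (th i) (F i)) ->
    log_volume_loss F <= n%:R * (d%:R * (6 * ln T%:R)).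
  move=> inv; rewrite -[n in n%:R]card_ord mulr_natl -sumr_const; apply: ler_sum => i _.
  apply: le_trans (search_invariant_ln_det d_gt0 delta0 (inv i)) _.
  by rewrite ler_wpM2l // ln_16_sqr_le.
apply: le_trans sum_le _; rewrite !natrX.
(* Integrality of [n] is kept for [n <= n^2] once [n] is generalised to a real. *)
have n1 : n%:R = 0 :> R \/ 1 <= n%:R :> R by case: (n) => [|k]; [left | right; rewrite ler1n].
have d1 : 1 <= d%:R :> R by rewrite ler1n.
have := loss_le _ _ invS; have := loss_le _ _ invB.
have -> : T%:R * (n%:R * (2 * delta)) = 2 * n%:R by rewrite /delta; field; rewrite gt_eqF.
move: (log_volume_loss _) (log_volume_loss _) => lS lB hB hS.
move: n%:R d%:R (ln _) n1 d1 lnT hB hS => a b l a1 b1 l1 hB hS.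
have a0 : 0 <= a by case: a1; lra.
have first_le : a * (b + 1) * (lS + lB) <= a * (2 * b) * (2 * (a * (b * (6 * l)))).
  apply: (@le_trans _ _ (a * (b + 1) * (2 * (a * (b * (6 * l)))))).
    by rewrite ler_wpM2l ?mulr_ge0 //; lra.
  rewrite ler_wpM2r ?mulr_ge0 ?ler_wpM2l //; lra.
have second_le : 2 * a <= 4 * (a * (a * b ^+ 2) * l).
  case: a1 => [->|a1]; first by rewrite !(mul0r, mulr0).
  have ab : 1 <= a * b ^+ 2 by rewrite -[1]mulr1 ler_pM // exprn_ege1.
  have : a * 1 <= a * (a * b ^+ 2) by rewrite ler_wpM2l //; lra.
  have h0 : 0 <= a * (a * b ^+ 2) by rewrite mulr_ge0 //; lra.
  have : a * (a * b ^+ 2) * (1 / 2) <= a * (a * b ^+ 2) * l by rewrite ler_wpM2l.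
  lra.
apply: le_trans (lerD first_le second_le) _.
by rewrite le_eqVlt; apply/orP; left; apply/eqP; ring.
Qed.
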